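(* Given $\alpha>0$ and a real number $p\ge1$, there exist $\gamma>0$ and a Banach space $X_\alpha$, a bounded $C_0$-semigroup $(T(t))_{t\ge0}$ on $X_\alpha$ with generator $A$, and a vector $f\in X_\alpha$, such that (a) $\|R(is,A)\|_{\mathcal L(X_\alpha)}=O\big((\log|s|)^\alpha\big)$ as $|s|\to\infty$, (b) $\displaystyle\int_0^\infty\|T(t)f\|_{X_\alpha}^p\,dt<\infty$, (c) $\displaystyle\int_0^\infty\|T(t)A^{-1}f\|_{X_\alpha}^p\,e^{\gamma t^{1/(\alpha+1)}}\,dt=\infty$.
   Context: $R(\lambda,A)=(\lambda-A)^{-1}$, $\mathcal L(X_\alpha)$ is the space of bounded linear operators on $X_\alpha$, and a semigroup is bounded if $\sup_{t\ge0}\|T(t)\|<\infty$. Banach spaces are complex. The existence of the operators $R(is,A)$ and $A^{-1}$ appearing in (a) and (c) is part of the assertion. *)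

(* Defs.v *)
(* R : realType is the real line; a complex Banach space is a
   completeNormedModType over R[i]. *)
From HB Require Import structures.
From mathcomp Require Import all_boot all_order all_algebra.
From mathcomp Require Import all_classical all_reals all_analysis.
From mathcomp Require Import complex.

Set Implicit Arguments.
Unset Strict Implicit.
Unset Printing Implicit Defensive.

Import Order.TTheory GRing.Theory Num.Theory.
Import numFieldNormedType.Exports.

Local Open Scope classical_set_scope.
Local Open Scope ring_scope.
Local Open Scope complex_scope.

Section Banach.
Context {R : realType} {X : completeNormedModType R[i]}.

(* `|x| lives in R[i] and is a nonnegative real there; take its real part. *)
Definition rnorm (x : X) : R := complex.Re `|x|.

(* Valued in \bar R, so that it is +oo when B is unbounded. *)
Definition opnorm (B : X -> X) : \bar R :=
  ereal_sup [set (rnorm (B x))%:E | x in [set x | rnorm x <= 1]].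

Definition bounded_op (B : X -> X) : Prop := (opnorm B < +oo)%E.

(* A not necessarily bounded operator; only the values of [app] on [dom] are
   meaningful. *)
Record operator := Operator { dom : set X ; app :> X -> X }.

(* lambda - A, with the same domain as A. *)
Definition resolvent_shift (lambda : R[i]) (A : operator) : operator :=
  Operator (dom A) (fun x => lambda *: x - A x).

(* B = A^-1 : A is a bijection from its domain onto X, and its inverse B is a
   bounded linear operator on X. *)
Definition is_inverse (A : operator) (B : {linear X -> X}) : Prop :=
  [/\ bounded_op B,
      forall x, dom A (B x) /\ A (B x) = x &
      forall x, dom A x -> B (A x) = x].

(* B = R(lambda, A) *)
Definition is_resolvent (lambda : R[i]) (A : operator)
    (B : {linear X -> X}) : Prop :=
  is_inverse (resolvent_shift lambda A) B.

(* Only the operators T t with 0 <= t matter. *)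
Definition C0_semigroup (T : R -> {linear X -> X}) : Prop :=
  [/\ forall t, 0 <= t -> bounded_op (T t),
      forall x, T 0 x = x,
      forall s t x, 0 <= s -> 0 <= t -> T (s + t) x = T s (T t x) &
      forall x, T t x @[t --> 0^'+] --> x].

Definition bounded_semigroup (T : R -> {linear X -> X}) : Prop :=
  (ereal_sup [set opnorm (T t) | t in [set t | (0 <= t)%R]] < +oo)%E.

Definition diff_quot (T : R -> {linear X -> X}) (x : X) (h : R) : X :=
  (h^-1)%:C *: (T h x - x).

Definition generator (T : R -> {linear X -> X}) : operator :=
  Operator [set x | cvg (diff_quot T x h @[h --> 0^'+])]
           (fun x => lim (diff_quot T x h @[h --> 0^'+])).

End Banach.

Arguments operator {R} X.

(* Main.v *)
Require Import Defs.
From HB Require Import structures.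
From mathcomp Require Import all_boot all_order all_algebra.
From mathcomp Require Import all_classical all_reals all_analysis.
From mathcomp Require Import measurable_realfun complex.
From mathcomp Require Import ring lra.

(** The space X is the complex c_0, the sequences tending to 0 with the
    supremum norm, and T(t) multiplies the n-th coordinate by exp(t lambda_n),
    where lambda_n = - L^(-alpha) + i e^L and L = n + 1.  All real parts are
    negative, so T is a contraction semigroup, and its generator is the
    multiplication by lambda_n with its maximal domain
    ([generator_dsemigroup]); the resolvent at mu, if it exists, is the
    multiplication by 1/(mu - lambda_n).

    (a) For a real s, an eigenvalue whose frequency e^L is at most 2|s| has
    L = O(log |s|), and is - lambda_n has real part L^(-alpha), so its inverse
    is O((log |s|)^alpha).  The remaining frequencies are at distance at least
    |s| from s, where the inverse is bounded ([resolvent_symbol_le]).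

    (b) The vector f has coordinates e^(-L).  The n-th coordinate of T(t)f has
    modulus exp(-L - t L^(-alpha)), and maximising over L shows that the norm
    decays faster than every power of t; decay like 1/(1+t^2) is enough
    ([rnorm_orbit_le]).

    (c) Applying A^(-1) costs a factor of about e^(-L) in the n-th coordinate.
    At times t close to tau = L^(alpha+1) the damping exp(-t L^(-alpha)) is also
    about e^(-L), so that ||T(t) A^(-1) f|| is at least about e^(-3L)
    ([rnorm_orbit_inverse_ge]).  Since t^(1/(alpha+1)) is at least L there,
    the weight with gamma = 3p + 1 more than compensates, and the integral over
    [tau, tau + 1] alone is at least a constant times e^L, for every L.

    Strong continuity of T and the identification of its generator are both
    instances of a dominated convergence principle in c_0
    ([c0_dominated_cvg]). *)

Set Implicit Arguments.
Unset Strict Implicit.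
Unset Printing Implicit Defensive.

Import Order.TTheory GRing.Theory Num.Theory.
Import numFieldNormedType.Exports.
Import ComplexField.Normc.

Local Open Scope classical_set_scope.
Local Open Scope ring_scope.
Local Open Scope complex_scope.

(** * The Banach space of complex null sequences *)

Section NullSequences.
Context {R : realType}.
Implicit Types x y : nat -> R[i].

Lemma normc_ge0 (z : R[i]) : 0 <= normc z.
Proof. by case: z => a b; exact: sqrtr_ge0. Qed.

Lemma normcB_sym (z w : R[i]) : normc (z - w) = normc (w - z).
Proof. by rewrite -normcN opprB. Qed.

Lemma normc_real (x : R) : 0 <= x -> normc x%:C = x.
Proof. by move=> x0; rewrite /= expr0n/= addr0 sqrtr_sqr ger0_norm. Qed.

Lemma ReB (z w : R[i]) : complex.Re (z - w) = complex.Re z - complex.Re w.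
Proof. by case: z w => [a b] [c d]. Qed.

Lemma ImB (z w : R[i]) : complex.Im (z - w) = complex.Im z - complex.Im w.
Proof. by case: z w => [a b] [c d]. Qed.

Lemma ReZ (r : R) (z : R[i]) : complex.Re (r%:C * z) = r * complex.Re z.
Proof. by case: z => a b /=; rewrite mul0r subr0. Qed.

Lemma ImZ (r : R) (z : R[i]) : complex.Im (r%:C * z) = r * complex.Im z.
Proof. by case: z => a b /=; rewrite mul0r addr0. Qed.

Lemma normc_le_ReIm (z : R[i]) :
  normc z <= `|complex.Re z| + `|complex.Im z|.
Proof.
case: z => a b /=; rewrite -[leRHS]ger0_norm ?addr_ge0// -sqrtr_sqr.
rewrite ler_sqrt ?sqr_ge0// sqrrD !real_normK ?num_real // addrAC lerDl.
by rewrite mulrn_wge0// mulr_ge0.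
Qed.

Lemma Re_le_normc (z : R[i]) : `|complex.Re z| <= normc z.
Proof.
case: z => a b /=; rewrite -sqrtr_sqr ler_sqrt ?addr_ge0 ?sqr_ge0//.
by rewrite lerDl sqr_ge0.
Qed.

Lemma Im_le_normc (z : R[i]) : `|complex.Im z| <= normc z.
Proof.
case: z => a b /=; rewrite -sqrtr_sqr ler_sqrt ?addr_ge0 ?sqr_ge0//.
by rewrite lerDr sqr_ge0.
Qed.

Definition null_seq x : Prop :=
  forall e : R, 0 < e -> \forall n \near \oo, normc (x n) <= e.

(** The boolean form lets c_0 be built as a submodule of all sequences. *)
Definition null_seqb : {pred nat -> R[i]} := fun x => `[< null_seq x >].

Lemma null_seq_bounded x : null_seq x -> exists M, forall n, normc (x n) <= M.
Proof.
move=> /(_ 1 ltr01)[N _ xN].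
exists (\sum_(i < N) normc (x i) + 1) => n; case: (ltnP n N) => nN.
  rewrite (bigD1 (Ordinal nN))//= -addrA lerDl addr_ge0//.
  by apply: sumr_ge0 => i _; exact: normc_ge0.
apply: le_trans (xN n nN) _; rewrite lerDr.
by apply: sumr_ge0 => i _; exact: normc_ge0.
Qed.

Lemma null_seq_mul (b x : nat -> R[i]) (M : R) :
  (forall n, normc (b n) <= M) -> null_seq x -> null_seq (fun n => b n * x n).
Proof.
move=> bM x0 e e0.
have M0 : 0 < M + 1 by rewrite ltr_wpDl// (le_trans _ (bM 0%N))// normc_ge0.
near=> n; rewrite normcM.
have xn : normc (x n) <= e / (M + 1).
  by near: n; apply: x0; rewrite divr_gt0.
have : normc (b n) * normc (x n) <= (M + 1) * (e / (M + 1)).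
  by apply: ler_pM; rewrite ?normc_ge0// (le_trans (bM n))// lerDl.
by rewrite mulrCA divff ?mulr1// gt_eqF.
Unshelve. all: by end_near. Qed.

Lemma null_seq_closed : subsemimod_closed null_seqb.
Proof.
split; first split.
- apply/asboolP => e e0; near=> n.
  by rewrite [(0 : nat -> R[i]) n]/(0 : R[i]) normc0 ltW.
- move=> x y /asboolP x0 /asboolP y0; apply/asboolP => e e0.
  near=> n.
  rewrite [(x + y) n]/(x n + y n) (splitr e).
  apply: (le_trans (le_normcD _ _)).
  by apply: lerD; near: n; [apply: x0|apply: y0]; rewrite divr_gt0.
- move=> a x /asboolP x0; apply/asboolP.
  exact: (@null_seq_mul (fun=> a) x (normc a)).
Unshelve. all: by end_near. Qed.

End NullSequences.

HB.instance Definition _ (R : realType) :=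
  GRing.isSubmodClosed.Build R[i] (nat -> R[i]) (@null_seqb R) null_seq_closed.

Record c0 (R : realType) :=
  C0seq { c0val :> nat -> R[i] ; c0valP : c0val \in @null_seqb R }.

HB.instance Definition _ (R : realType) := [isSub for @c0val R].
HB.instance Definition _ (R : realType) := [Choice of c0 R by <:].
HB.instance Definition _ (R : realType) := [SubChoice_isSubLmodule of c0 R by <:].

Section C0Norm.
Context {R : realType}.
Implicit Types x y : c0 R.

Lemma c0P x : null_seq x.
Proof. exact/asboolP/c0valP. Qed.

Lemma c0D x y n : (x + y) n = x n + y n. Proof. by []. Qed.
Lemma c0B x y n : (x - y) n = x n - y n. Proof. by []. Qed.
Lemma c0Z (a : R[i]) x n : (a *: x) n = a * x n. Proof. by []. Qed.

Lemma c0_eq x y : (forall n, x n = y n) -> x = y.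
Proof. by move=> xy; apply/val_inj/funext. Qed.

Definition c0norm x : R := sup (range (fun n => normc (x n))).

Lemma normc_le_c0norm x n : normc (x n) <= c0norm x.
Proof.
have [M xM] := null_seq_bounded (c0P x).
by apply: ub_le_sup; [exists M => _ [k _ <-]|exists n].
Qed.

Lemma c0norm_le x (M : R) : (forall n, normc (x n) <= M) -> c0norm x <= M.
Proof.
move=> xM; apply: ge_sup; first by exists (normc (x 0%N)), 0%N.
by move=> _ [k _ <-].
Qed.

Lemma c0norm_ge0 x : 0 <= c0norm x.
Proof. exact: le_trans (normc_ge0 _) (normc_le_c0norm x 0). Qed.

Lemma c0normD x y : c0norm (x + y) <= c0norm x + c0norm y.
Proof.
apply: c0norm_le => n; apply: (le_trans (le_normcD _ _)).
by apply: lerD; exact: normc_le_c0norm.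
Qed.

Lemma c0normZ_le (a : R[i]) x : c0norm (a *: x) <= normc a * c0norm x.
Proof.
apply: c0norm_le => n; rewrite c0Z normcM ler_wpM2l ?normc_ge0//.
exact: normc_le_c0norm.
Qed.

(** The reverse of [c0normZ_le] comes from applying it to the scalar 1/a. *)
Lemma c0normZ (a : R[i]) x : c0norm (a *: x) = normc a * c0norm x.
Proof.
apply/eqP; rewrite eq_le c0normZ_le /=.
have [->|a0] := eqVneq a 0; first by rewrite normc0 mul0r c0norm_ge0.
have na0 : 0 < normc a.
  by rewrite lt_neqAle normc_ge0 andbT eq_sym; apply: contra a0 => /eqP/eq0_normc ->.
rewrite mulrC -ler_pdivlMr// mulrC -normcV.
by rewrite -[in leLHS](scalerK a0 x) c0normZ_le.
Qed.

Lemma c0norm_eq0 x : c0norm x = 0 -> x = 0.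
Proof.
move=> x0; apply: c0_eq => n; apply: eq0_normc; apply/eqP.
by rewrite eq_le normc_ge0 andbT -x0 normc_le_c0norm.
Qed.

Let cnorm x : R[i] := (c0norm x)%:C.

Let cnormD x y : cnorm (x + y) <= cnorm x + cnorm y.
Proof. by rewrite /cnorm -rmorphD lecR c0normD. Qed.

Let cnormZ (a : R[i]) x : cnorm (a *: x) = `|a| * cnorm x.
Proof. by rewrite /cnorm c0normZ rmorphM. Qed.

Let cnorm_eq0 x : cnorm x = 0 -> x = 0.
Proof. by move=> /complexI/c0norm_eq0. Qed.

HB.instance Definition _ :=
  Lmodule_isNormed.Build R[i] (c0 R) cnormD cnormZ cnorm_eq0.

Lemma c0_normE x : `|x| = (c0norm x)%:C. Proof. by []. Qed.

(** The norm of c_0 takes its values in R[i]; this brings convergence back to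
    estimates between real numbers. *)
Lemma c0_cvgP T (F : set_system T) {FF : Filter F} (g : T -> c0 R) x :
  (forall e : R, 0 < e -> \forall t \near F, c0norm (x - g t) <= e) <->
  g @ F --> x.
Proof.
split=> [gx|/cvgrPdist_le gx e e0].
  apply/cvgrPdist_le => e e0.
  have eE : e = (complex.Re e)%:C by rewrite RRe_real// gtr0_real.
  rewrite eE ltcR in e0.
  by near=> t; rewrite c0_normE eE lecR; near: t; exact: gx.
have /gx : 0 < e%:C by rewrite ltcR.
by apply: filterS => t; rewrite c0_normE lecR.
Unshelve. all: by end_near. Qed.

(** The coordinates of a Cauchy filter converge because R is complete.  An
    element of the filter that is uniformly e-close to all the others is then
    uniformly 2e-close to the coordinatewise limit, which forces this limit to
    be a null sequence and the filter to converge to it in norm. *)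
Lemma c0_complete (F : set_system (c0 R)) :
  ProperFilter F -> cauchy F -> cvg F.
Proof.
move=> FF Fc.
have Fball (e : R) : 0 < e ->
    exists x, \forall y \near F, c0norm (x - y) <= e.
  move=> e0; have eC : 0 < e%:C :> R[i] by rewrite ltcR.
  have [x Fx] := (cauchyP F).1 Fc _ eC.
  exists x; apply: filterS Fx => y.
  by rewrite -ball_normE /= c0_normE ltcR => /ltW.
have coord_cvg (g : R[i] -> R) :
    (forall z w, `|g z - g w| <= normc (z - w)) ->
    forall n, (fun x : c0 R => g (x n)) @ F --> lim ((fun x : c0 R => g (x n)) @ F).
  move=> gL n; apply/cauchy_cvgP/cauchy_exP => e e0.
  have e20 : 0 < e / 2 by rewrite divr_gt0.
  have [x Fx] := Fball _ e20.
  exists (g (x n)); apply: filterS Fx => y xy.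
  rewrite -ball_normE /=; apply: (le_lt_trans (gL _ _)).
  apply: (le_lt_trans (normc_le_c0norm (x - y) n)).
  by apply: le_lt_trans xy _; rewrite gtr_pMr// invf_lt1// ltr1n.
pose lRe n := lim ((fun x : c0 R => complex.Re (x n)) @ F).
pose lIm n := lim ((fun x : c0 R => complex.Im (x n)) @ F).
pose l n := lRe n +i* lIm n.
have FRe n : (fun x : c0 R => complex.Re (x n)) @ F --> lRe n.
  by apply: coord_cvg => z w; rewrite -ReB Re_le_normc.
have FIm n : (fun x : c0 R => complex.Im (x n)) @ F --> lIm n.
  by apply: coord_cvg => z w; rewrite -ImB Im_le_normc.
have lball (e : R) x : 0 < e -> (\forall y \near F, c0norm (x - y) <= e) ->
    forall n, normc (l n - x n) <= 2 * e.
  move=> e0 Fx n; near F => y.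
  have -> : l n - x n = (l n - y n) - (x n - y n) by rewrite opprB addrA subrK.
  rewrite (_ : 2 * e = (e / 2 + e / 2) + e); last lra.
  apply: (le_trans (le_normcD _ _)); rewrite normcN; apply: lerD; last first.
    by apply: (le_trans (normc_le_c0norm (x - y) n)); near: y.
  apply: (le_trans (normc_le_ReIm _)); apply: lerD.
    by rewrite ReB; near: y; apply: cvgr_dist_le => //; rewrite divr_gt0.
  by rewrite ImB; near: y; apply: cvgr_dist_le => //; rewrite divr_gt0.
have l0 : null_seq l.
  move=> e e0; have e30 : 0 < e / 3 by rewrite divr_gt0.
  have [x Fx] := Fball _ e30.
  near=> n; rewrite -(subrK (x n) (l n)).
  rewrite (_ : e = 2 * (e / 3) + e / 3); last by field.
  apply: (le_trans (le_normcD _ _)); apply: lerD; first exact: lball.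
  by near: n; exact: c0P.
have l0b : l \in @null_seqb R by apply/asboolP.
apply/cvg_ex; exists (C0seq l0b); apply/c0_cvgP => e e0.
have e30 : 0 < e / 3 by rewrite divr_gt0.
have [x Fx] := Fball _ e30.
near=> y; apply: c0norm_le => n; rewrite c0B /=.
have -> : l n - y n = (l n - x n) + (x n - y n) by rewrite addrA subrK.
rewrite (_ : e = 2 * (e / 3) + e / 3); last by field.
apply: (le_trans (le_normcD _ _)); apply: lerD; first exact: lball.
by apply: (le_trans (normc_le_c0norm (x - y) n)); near: y.
Unshelve. all: by end_near. Qed.

HB.instance Definition _ := Uniform_isComplete.Build (c0 R) c0_complete.

Lemma c0_rnormE x : rnorm x = c0norm x. Proof. by []. Qed.

End C0Norm.

(** * Diagonal operators and dominated convergence *)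

Section DominatedConvergence.
Context {R : realType}.

(** Domination by a fixed z makes all coordinates beyond some N uniformly
    small; only finitely many remain, and these converge by hypothesis. *)
Lemma c0_dominated_cvg T (F : set_system T) {FF : Filter F}
    (g : T -> c0 R) (l z : c0 R) (M : R) :
  (\forall t \near F, forall n, normc (l n - g t n) <= M * normc (z n)) ->
  (forall n e, 0 < e -> \forall t \near F, normc (l n - g t n) <= e) ->
  g @ F --> l.
Proof.
move=> gM gn; apply/c0_cvgP => e e0.
have M0 : 0 < `|M| + 1 by rewrite ltr_wpDl.
have [N _ zN] := c0P z (divr_gt0 e0 M0).
have gN : \forall t \near F, forall i : 'I_N, normc (l i - g t i) <= e.
  by apply: filter_forall => i; exact: gn.
near=> t; apply: c0norm_le => n; rewrite c0B.
have [nN|Nn] := ltnP n N.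
  have : forall i : 'I_N, normc (l i - g t i) <= e by near: t.
  by move=> /(_ (Ordinal nN)).
have gtM : forall n, normc (l n - g t n) <= M * normc (z n) by near: t.
apply: (le_trans (gtM n)).
apply: (@le_trans _ _ ((`|M| + 1) * normc (z n))).
  rewrite ler_wpM2r ?normc_ge0//; apply: (le_trans (ler_norm M)).
  by rewrite lerDl.
have -> : e = (`|M| + 1) * (e / (`|M| + 1)) by rewrite mulrCA divff ?mulr1 ?gt_eqF.
by rewrite ler_wpM2l ?(ltW M0)// zN.
Unshelve. all: by end_near. Qed.

End DominatedConvergence.

Section DiagonalOperators.
Context {R : realType}.

Record bounded_seq := BoundedSeq {
  bval :> nat -> R[i] ;
  bvalP : exists M, forall n, normc (bval n) <= M }.

Lemma diag_null (b : bounded_seq) (x : c0 R) :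
  (fun n => b n * x n) \in @null_seqb R.
Proof. by apply/asboolP; have [M bM] := bvalP b; exact: null_seq_mul bM (c0P x). Qed.

Definition diag (b : bounded_seq) (x : c0 R) : c0 R := C0seq (diag_null b x).

Lemma diagE b x n : diag b x n = b n * x n. Proof. by []. Qed.

Lemma diag_linear b : linear (diag b).
Proof.
move=> a x y; apply: c0_eq => n.
by rewrite diagE !c0D !c0Z !diagE mulrDr mulrCA.
Qed.

HB.instance Definition _ b :=
  GRing.isLinear.Build R[i] (c0 R) (c0 R) *:%R (diag b) (diag_linear b).

Lemma opnorm_diag_le (b : bounded_seq) (M : R) :
  (forall n, normc (b n) <= M) -> (opnorm (diag b) <= M%:E)%E.
Proof.
move=> bM; have M0 : 0 <= M := le_trans (normc_ge0 _) (bM 0%N).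
apply: ge_ereal_sup => _ [x /= x1 <-]; rewrite lee_fin c0_rnormE.
apply: c0norm_le => n; rewrite diagE normcM -[leRHS]mulr1.
apply: ler_pM; rewrite ?normc_ge0//.
exact: le_trans (normc_le_c0norm x n) x1.
Qed.

Lemma bounded_op_diag b : bounded_op (diag b).
Proof.
have [M bM] := bvalP b.
exact: le_lt_trans (opnorm_diag_le bM) (ltry M).
Qed.

End DiagonalOperators.
Arguments bounded_seq R : clear implicits.

(** * The scalar functions exp(t(-a + iw)) *)

Section DampedOscillation.
Context {R : realType}.
Implicit Types t a w : R.

(** This is exp(t(-a + iw)). *)
Definition damped a w t : R[i] :=
  (expR (- (t * a)) * cos (t * w)) +i* (expR (- (t * a)) * sin (t * w)).

Lemma damped0 a w : damped a w 0 = 1.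
Proof. by rewrite /damped !mul0r oppr0 expR0 cos0 sin0 mulr1 mulr0. Qed.

Lemma dampedD a w s t : damped a w (s + t) = damped a w s * damped a w t.
Proof.
rewrite /damped !mulrDl opprD expRD cosD sinD; apply/eqP.
by rewrite eq_complex /=; apply/andP; split; apply/eqP; ring.
Qed.

Lemma normc_damped a w t : normc (damped a w t) = expR (- (t * a)).
Proof.
by rewrite /= !exprMn -mulrDr cos2Dsin2 mulr1 sqrtr_sqr ger0_norm ?expR_ge0.
Qed.

Lemma normc_damped_le1 a w t : 0 <= a -> 0 <= t -> normc (damped a w t) <= 1.
Proof. by move=> a0 t0; rewrite normc_damped expR_le1 oppr_le0 mulr_ge0. Qed.

Let dRe a w t : R :=
  expR (- (t * a)) * (- a * cos (t * w) - w * sin (t * w)).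
Let dIm a w t : R :=
  expR (- (t * a)) * (- a * sin (t * w) + w * cos (t * w)).

Lemma is_derive_Re_damped a w t :
  is_derive t 1 (fun t => complex.Re (damped a w t)) (dRe a w t).
Proof.
rewrite /damped/=.
apply: is_derive_eq; rewrite /dRe /GRing.scale /=; ring.
Qed.

Lemma is_derive_Im_damped a w t :
  is_derive t 1 (fun t => complex.Im (damped a w t)) (dIm a w t).
Proof.
rewrite /damped/=.
apply: is_derive_eq; rewrite /dIm /GRing.scale /=; ring.
Qed.

Lemma lipschitz_at0 (f df : R -> R) (K t : R) :
  (forall x : R, is_derive x 1 f (df x)) ->
  (forall x, 0 <= x -> `|df x| <= K) -> 0 <= t -> `|f t - f 0| <= K * t.
Proof.
move=> fdf dfK t_ge0; have [->|t_neq0] := eqVneq t 0.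
  by rewrite subrr normr0 mulr0.
have t0 : 0 < t by rewrite lt_neqAle eq_sym t_neq0.
have fc : {within `[0, t], continuous f}.
  apply: continuous_subspaceT => x; have [df1 _] := fdf x.
  by apply: differentiable_continuous; apply/derivable1_diffP.
have [x] := MVT t0 (fun x _ => fdf x) fc.
rewrite in_itv/= => /andP[x0 _] ->.
by rewrite subr0 normrM (ger0_norm (ltW t0)) ler_wpM2r ?(ltW t0)// dfK// ltW.
Qed.

(** The domination needed for the difference quotients of the semigroup: they
    are bounded by a multiple of the eigenvalue, uniformly in t.  The mean value
    theorem is used on each of the real and imaginary parts, hence a constant
    larger than the optimal 1. *)
Lemma damped_sub1 a w t : 0 <= a -> 0 <= t ->
  normc (damped a w t - 1) <= 4 * normc ((- a) +i* w) * t.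
Proof.
move=> a0 t0.
have := Im_le_normc ((- a) +i* w); have := Re_le_normc ((- a) +i* w).
rewrite [complex.Re _]/= [complex.Im _]/= normrN (ger0_norm a0).
move: (normc ((- a) +i* w)) => K aK wK.
have bnd (u v x : R) : 0 <= x -> `|u| <= 1 -> `|v| <= 1 ->
    `|expR (- (x * a)) * (- a * u + w * v)| <= 2 * K.
  move=> x0 u1 v1; rewrite normrM ger0_norm ?expR_ge0// -[leRHS]mul1r.
  apply: ler_pM => //; rewrite ?expR_ge0 ?expR_le1 ?oppr_le0 ?mulr_ge0//.
  apply: (le_trans (ler_normD _ _)); rewrite !normrM normrN (ger0_norm a0).
  by rewrite mulr_natl mulr2n lerD// -[leRHS]mulr1 ler_pM.
have -> : 4 * K * t = 2 * K * t + 2 * K * t by lra.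
have HRe : `|complex.Re (damped a w t) - complex.Re (damped a w 0)| <= 2 * K * t.
  apply: (lipschitz_at0 (is_derive_Re_damped a w)) => // x x0.
  rewrite /dRe -(mulrN w); apply: bnd => //; first exact: cos_max.
  by rewrite normrN sin_max.
have HIm : `|complex.Im (damped a w t) - complex.Im (damped a w 0)| <= 2 * K * t.
  apply: (lipschitz_at0 (is_derive_Im_damped a w)) => // x x0.
  by apply: bnd => //; [exact: sin_max|exact: cos_max].
rewrite damped0 in HRe HIm.
by apply: (le_trans (normc_le_ReIm _)); rewrite ReB ImB lerD.
Qed.

Let diff_quot0 (f : R -> R) (d e : R) : is_derive (0 : R) 1 f d -> 0 < e ->
  \forall h \near 0^'+, `|d - h^-1 * (f h - f 0)| <= e.
Proof.
move=> [df <-] e0.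
have /cvgrPdist_le /(_ _ e0) := df.
rewrite !near_withinE.
apply: filterS => h + h0; rewrite gt_eqF// => /(_ isT).
by rewrite /GRing.scale/= mulr1 addr0.
Qed.

Lemma damped_diff_quot a w e : 0 < e ->
  \forall h \near 0^'+,
    normc (((- a) +i* w) - (h^-1)%:C * (damped a w h - 1)) <= e.
Proof.
move=> e0; have e20 : 0 < e / 2 by rewrite divr_gt0.
have HRe := diff_quot0 (is_derive_Re_damped a w 0) e20.
have HIm := diff_quot0 (is_derive_Im_damped a w 0) e20.
have dRe0 : dRe a w 0 = - a.
  by rewrite /dRe !mul0r oppr0 expR0 cos0 sin0 mulr0 subr0 mulr1 mul1r.
have dIm0 : dIm a w 0 = w.
  by rewrite /dIm !mul0r oppr0 expR0 cos0 sin0 mulr0 add0r mulr1 mul1r.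
rewrite dRe0 damped0 in HRe; rewrite dIm0 damped0 in HIm.
apply: filterS2 HRe HIm => h HRe HIm.
rewrite (splitr e).
apply: (le_trans (normc_le_ReIm _)); apply: lerD.
  by rewrite ReB ReZ ReB.
by rewrite ImB ImZ ImB.
Qed.

End DampedOscillation.

(** * Diagonal semigroups and their generators *)

Section DiagonalSemigroup.
Context {R : realType}.
Variables a w : nat -> R.
Hypothesis a_ge0 : forall n, 0 <= a n.

Definition diag_eigenvalue n : R[i] := (- a n) +i* w n.

Lemma damped_bounded (t : R) : exists M, forall n, normc (damped (a n) (w n) `|t|) <= M.
Proof. by exists 1 => n; rewrite normc_damped_le1. Qed.

(** Taking the absolute value of t makes the multiplier bounded, hence the
    operator everywhere defined, also at negative times. *)
Definition dsemigroup t : {linear c0 R -> c0 R} := diag (BoundedSeq (damped_bounded t)).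

Lemma dsemigroupE t x n : 0 <= t ->
  dsemigroup t x n = damped (a n) (w n) t * x n.
Proof. by move=> t0; rewrite -{2}(ger0_norm t0). Qed.

Lemma opnorm_dsemigroup_le1 t : (opnorm (dsemigroup t) <= 1)%E.
Proof. by apply: opnorm_diag_le => n; rewrite normc_damped_le1. Qed.

Lemma dsemigroup_bounded : bounded_semigroup dsemigroup.
Proof.
apply: (@le_lt_trans _ _ 1%E); last exact: ltry.
by apply: ge_ereal_sup => _ [t _ <-]; exact: opnorm_dsemigroup_le1.
Qed.

Lemma dsemigroup_C0 : C0_semigroup dsemigroup.
Proof.
split.
- by move=> t _; exact: bounded_op_diag.
- by move=> x; apply: c0_eq => n; rewrite dsemigroupE// damped0 mul1r.
- move=> s t x s0 t0; apply: c0_eq => n.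
  by rewrite !dsemigroupE ?addr_ge0// dampedD mulrA.
- move=> x; apply: (@c0_dominated_cvg _ _ _ _ _ _ x 2).
    near=> t => n; have t0 : 0 <= t by [].
    rewrite dsemigroupE// -[X in X - _]mul1r -mulrBl normcM.
    rewrite ler_wpM2r ?normc_ge0//; apply: (le_trans (le_normcD _ _)).
    by rewrite normcN normc1 (_ : 2 = 1 + 1)// lerD2l normc_damped_le1.
  move=> n e e0; set K := 4 * normc ((- a n) +i* w n) * normc (x n) + 1.
  have K0 : 0 < K by rewrite ltr_wpDl// !mulr_ge0 ?normc_ge0.
  near=> t; have t0 : 0 <= t by [].
  rewrite dsemigroupE// -[X in X - _]mul1r -mulrBl normcM normcB_sym.
  apply: (@le_trans _ _ (K * t)); last first.
    rewrite mulrC -ler_pdivlMr//; near: t.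
    by apply: nbhs_right_le; rewrite divr_gt0.
  apply: (@le_trans _ _ (4 * normc ((- a n) +i* w n) * t * normc (x n))).
    by rewrite ler_wpM2r ?normc_ge0// damped_sub1.
  by rewrite mulrAC ler_wpM2r// /K lerDl.
Unshelve. all: by end_near. Qed.

Lemma dsemigroup_diff_quotE (y : c0 R) h n : 0 < h ->
  diff_quot dsemigroup y h n =
    (h^-1)%:C * (damped (a n) (w n) h - 1) * y n.
Proof.
move=> h0; rewrite /diff_quot c0Z c0B dsemigroupE ?(ltW h0)//.
by rewrite -mulrA mulrBl mul1r.
Qed.

Lemma dsemigroup_diff_quot_coord (y : c0 R) n e : 0 < e ->
  \forall h \near 0^'+,
    normc (diag_eigenvalue n * y n - diff_quot dsemigroup y h n) <= e.
Proof.
move=> e0; set K := normc (y n) + 1.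
have K0 : 0 < K by rewrite ltr_wpDl// normc_ge0.
have H := damped_diff_quot (a n) (w n) (divr_gt0 e0 K0).
near=> h; have h0 : 0 < h by [].
rewrite dsemigroup_diff_quotE// -mulrBl normcM.
have -> : e = e / K * K by rewrite divfK ?gt_eqF.
apply: ler_pM; rewrite ?normc_ge0//; last by rewrite lerDl.
by near: h; exact: H.
Unshelve. all: by end_near. Qed.

(** The difference quotients at y are dominated by a multiple of z, and not of
    y: this is why z being a null sequence is the right condition. *)
Lemma dsemigroup_diff_quot_cvg (y z : c0 R) :
  (forall n, z n = diag_eigenvalue n * y n) ->
  diff_quot dsemigroup y h @[h --> 0^'+] --> z.
Proof.
move=> zE; apply: (@c0_dominated_cvg _ _ _ _ _ _ z 5).
  near=> h => n; have h0 : 0 < h by [].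
  rewrite dsemigroup_diff_quotE//; apply: (le_trans (le_normcD _ _)).
  rewrite normcN normcM normcM.
  have -> : normc (h^-1)%:C = h^-1 by rewrite normc_real// invr_ge0 ltW.
  have : h^-1 * normc (damped (a n) (w n) h - 1) <= 4 * normc (diag_eigenvalue n).
    rewrite ler_pdivrMl// mulrC; exact: damped_sub1 (ltW h0).
  move=> /(ler_wpM2r (normc_ge0 (y n))); rewrite -[leRHS]mulrA -normcM -zE; lra.
by move=> n e e0; rewrite zE; exact: dsemigroup_diff_quot_coord.
Unshelve. all: by end_near. Qed.

Lemma dsemigroup_diff_quot_lim (y z : c0 R) :
  diff_quot dsemigroup y h @[h --> 0^'+] --> z ->
  forall n, z n = diag_eigenvalue n * y n.
Proof.
move=> /c0_cvgP yz n; apply/eqP; rewrite -subr_eq0; apply/eqP/eq0_normc.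
apply/eqP; rewrite eq_le normc_ge0 andbT; apply/ler_addgt0Pr => e e0.
rewrite add0r.
have e20 : 0 < e / 2 by rewrite divr_gt0.
have H := dsemigroup_diff_quot_coord y n e20.
near (0 : R)^'+ => h.
have -> : z n - diag_eigenvalue n * y n = (z - diff_quot dsemigroup y h) n -
    (diag_eigenvalue n * y n - diff_quot dsemigroup y h n).
  by rewrite c0B opprB addrA subrK.
rewrite (splitr e); apply: (le_trans (le_normcD _ _)); apply: lerD.
  by apply: (le_trans (normc_le_c0norm _ _)); near: h; exact: yz.
by rewrite normcN; near: h; exact: H.
Unshelve. all: by end_near. Qed.

(** The generator is the multiplication by the eigenvalues on its maximal
    domain: y is in the domain as soon as the product is in c_0. *)
Lemma generator_dsemigroup (y z : c0 R) :
  (dom (generator dsemigroup) y /\ generator dsemigroup y = z) <->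
  (forall n, z n = diag_eigenvalue n * y n).
Proof.
split=> [[/= cy yz]|zE].
  by apply: dsemigroup_diff_quot_lim; rewrite -yz.
have yz := dsemigroup_diff_quot_cvg zE.
split; first by apply/cvg_ex; exists z.
by apply/cvg_lim => //; exact: norm_hausdorff.
Qed.

Lemma is_resolvent_diag (mu : R[i]) (b : bounded_seq R) :
  (forall n, b n * (mu - diag_eigenvalue n) = 1) ->
  is_resolvent mu (generator dsemigroup) (diag b).
Proof.
move=> bmu; split.
- exact: bounded_op_diag.
- move=> x.
  have [] := (generator_dsemigroup (diag b x) (mu *: diag b x - x)).2 _.
    move=> n; rewrite c0B c0Z diagE -[X in _ - X]mul1r -(bmu n); ring.
  move=> ydom yE; split; first by [].
  rewrite [LHS]/(mu *: diag b x - generator dsemigroup (diag b x)) yE.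
  exact: subKr.
- move=> x xA.
  pose z : c0 R := generator dsemigroup x.
  have zE := (generator_dsemigroup x z).1 (conj xA erefl).
  rewrite [LHS]/(diag b (mu *: x - z)).
  by apply: c0_eq => n; rewrite diagE c0B c0Z zE -mulrBl mulrA bmu mul1r.
Qed.

Lemma is_inverse_diag (b : bounded_seq R) :
  (forall n, b n * diag_eigenvalue n = 1) ->
  is_inverse (generator dsemigroup) (diag b).
Proof.
move=> bmu; split.
- exact: bounded_op_diag.
- move=> x; apply/generator_dsemigroup => n.
  by rewrite diagE mulrA [_ * b n]mulrC bmu mul1r.
- move=> x xA; have Ax := (generator_dsemigroup x _).1 (conj xA erefl).
  by apply: c0_eq => n; rewrite diagE Ax mulrA bmu mul1r.
Qed.

End DiagonalSemigroup.

(** * Real inequalities and a comparison of integrals *)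

(** The integral of a nonnegative function is a supremum over the simple
    functions below it, so this is an inclusion between two sets of simple
    functions. *)
Lemma le_integral_nonneg d (T : measurableType d) (R : realType)
    (mu : {measure set T -> \bar R}) (E D : set T) (f g : T -> \bar R) :
  E `<=` D -> (forall x, E x -> (0 <= f x)%E) -> (forall x, D x -> (0 <= g x)%E) ->
  (forall x, E x -> (f x <= g x)%E) ->
  (\int[mu]_(x in E) f x <= \int[mu]_(x in D) g x)%E.
Proof.
move=> ED f0 g0 fg; rewrite !ge0_integralE//.
apply: le_ereal_sup => _ [h hf <-]; exists h => // x.
apply: (le_trans (hf x)); rewrite /patch; case: ifPn => [/set_mem Ex|_].
  by rewrite mem_set ?fg//; exact: ED.
by case: ifPn => [/set_mem/g0|].
Qed.

Section Estimates.
Context {R : realType}.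

Lemma le_powR2l (b x y : R) : 0 <= b -> 0 <= x -> x <= y -> x `^ b <= y `^ b.
Proof.
by move=> b0 x0 xy; apply: ge0_ler_powR; rewrite ?nnegrE// (le_trans x0).
Qed.

(** In logarithmic form, this is ln(x/b) <= x/b. *)
Lemma powR_le_expR (b x : R) : 0 < b -> 0 < x -> x `^ b <= b `^ b * expR x.
Proof.
move=> b0 x0; rewrite /powR !gt_eqF// -expRD ler_expR.
have := @ln_sublinear R (x / b) (divr_gt0 x0 b0).
rewrite ln_div ?posrE// ltr_pdivlMr// mulrBl => /ltW.
by rewrite lerBlDl mulrC [ln b * b]mulrC.
Qed.

Lemma sqr_le_expR (x : R) : 0 <= x -> x ^+ 2 <= 2 * expR x.
Proof.
move=> /(expR_ge1Dxn 1); rewrite (_ : 2`!%:R = 2)// => H.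
by rewrite -ler_pdivrMl//; apply: le_trans H; rewrite mulrC lerDr.
Qed.

End Estimates.

(** * The semigroup of the theorem *)

Section Example.
Context {R : realType}.
Variables (alpha p : R).
Hypotheses (alpha_gt0 : 0 < alpha) (p_ge1 : 1 <= p).

Definition freq (n : nat) : R := n.+1%:R.
Definition decay n : R := (freq n `^ alpha)^-1.
Definition osc n : R := expR (freq n).

Lemma freq_ge1 n : 1 <= freq n.
Proof. by rewrite /freq ler1n. Qed.

Lemma freq_gt0 n : 0 < freq n.
Proof. exact: lt_le_trans (freq_ge1 n). Qed.

Lemma decay_gt0 n : 0 < decay n.
Proof. by rewrite invr_gt0 powR_gt0 ?freq_gt0. Qed.

Lemma decay_le1 n : decay n <= 1.
Proof.
rewrite invf_le1 ?powR_gt0 ?freq_gt0//.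
by rewrite -(powRr0 (freq n)) ler_powR ?freq_ge1// ltW.
Qed.

Lemma decay_ge0 n : 0 <= decay n.
Proof. exact/ltW/decay_gt0. Qed.

Local Notation lam := (diag_eigenvalue decay osc).
Local Notation T := (dsemigroup osc decay_ge0).

Lemma shift_neq0 (s : R) n : (0 +i* s) - lam n != 0.
Proof.
apply/eqP => /(congr1 (@complex.Re R)) /=; rewrite sub0r opprK => /eqP.
by rewrite gt_eqF ?decay_gt0.
Qed.

(** The maximum with e makes this a bound for every real s, including those
    with log |s| small or negative. *)
Definition resolvent_bound (s : R) : R :=
  (2 * ln (Num.max `|s| (expR 1))) `^ alpha.

(** With m = max(|s|, e), a frequency at most 2m is at most m^2, so that its
    logarithm L is at most 2 ln m, and the real part L^(-alpha) bounds the
    distance from below.  A frequency above 2m is at distance at least m >= 1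
    from s. *)
Lemma resolvent_symbol_le (s : R) n :
  normc ((0 +i* s) - lam n)^-1 <= resolvent_bound s.
Proof.
rewrite normcV /resolvent_bound; set m := Num.max _ _; set N := normc _.
have N0 : 0 < N.
  rewrite lt_neqAle normc_ge0 andbT eq_sym.
  by apply: contra (shift_neq0 s n) => /eqP/eq0_normc ->.
have sm : `|s| <= m by rewrite le_max lexx.
have em : expR 1 <= m by rewrite le_max lexx orbT.
have m2 : 2 <= m.
  by apply: le_trans em; rewrite (_ : 2 = 1 + 1)// expR_ge1Dx.
have m0 : 0 < m by exact: lt_le_trans m2.
have lnm : 1 <= ln m by rewrite -(expRK 1) ler_ln// posrE ?expR_gt0.
have [wm|mw] := lerP (osc n) (2 * m).
  apply: (@le_trans _ _ (decay n)^-1).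
    rewrite lef_pV2 ?posrE ?decay_gt0//.
    apply: le_trans (Re_le_normc ((0 +i* s) - lam n)).
    by rewrite /= sub0r opprK ler_norm.
  rewrite invrK; apply: le_powR2l; [exact: ltW|exact/ltW/freq_gt0|].
  rewrite -(expRK (freq n)) mulr_natl mulr2n -lnM ?posrE//.
  rewrite ler_ln ?posrE ?expR_gt0 ?mulr_gt0//.
  by apply: (le_trans wm); rewrite ler_wpM2r// ltW.
apply: (@le_trans _ _ 1).
  rewrite invf_le1//; apply: le_trans (Im_le_normc ((0 +i* s) - lam n)).
  rewrite /= distrC; apply: le_trans (ler_norm _).
  have := ler_norm s; lra.
rewrite -[leLHS](powRr0 (2 * ln m)) ler_powR ?(ltW alpha_gt0)//; lra.
Qed.

Lemma resolvent_symbol_bounded (s : R) :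
  exists M, forall n, normc ((0 +i* s) - lam n)^-1 <= M.
Proof. by exists (resolvent_bound s) => n; exact: resolvent_symbol_le. Qed.

Definition resolvent (s : R) : {linear c0 R -> c0 R} :=
  diag (BoundedSeq (resolvent_symbol_bounded s)).

Lemma is_resolvent_dsemigroup (s : R) :
  is_resolvent (0 +i* s) (generator T) (resolvent s).
Proof. by apply: is_resolvent_diag => n; rewrite mulVf ?shift_neq0. Qed.

Lemma opnorm_resolvent_le (s : R) : expR 1 <= `|s| ->
  (opnorm (resolvent s) <= (2 `^ alpha * ln `|s| `^ alpha)%:E)%E.
Proof.
move=> s1; have ln0 : 0 <= ln `|s|.
  by rewrite ln_ge0// (le_trans _ s1)// -expR0 ler_expR.
rewrite -powRM//; apply: opnorm_diag_le => n.
by apply: (le_trans (resolvent_symbol_le s n)); rewrite /resolvent_bound max_l.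
Qed.

Lemma eigenvalue_symbol_bounded : exists M : R, forall n, normc (lam n)^-1 <= M.
Proof.
exists 1 => n; rewrite normcV.
have w1 : 1 <= normc (lam n).
  apply: le_trans (Im_le_normc (lam n)); rewrite /= ger0_norm ?expR_ge0//.
  by rewrite -expR0 ler_expR ltW// freq_gt0.
by rewrite invf_le1// (lt_le_trans _ w1).
Qed.

Definition generator_inv : {linear c0 R -> c0 R} :=
  diag (BoundedSeq eigenvalue_symbol_bounded).

Lemma is_inverse_generator_inv : is_inverse (generator T) generator_inv.
Proof.
apply: is_inverse_diag => n; rewrite mulVf//.
have := shift_neq0 0 n; apply: contra => /eqP ->; by rewrite subr0.
Qed.

Lemma initial_vec_null : (fun n => (expR (- freq n))%:C) \in @null_seqb R.
Proof.
apply/asboolP => e e0; near=> n.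
rewrite normc_real ?expR_ge0// expRN.
rewrite -[e]invrK lef_pV2 ?posrE ?expR_gt0 ?invr_gt0//.
apply: (@le_trans _ _ n%:R); first by near: n; exact: nbhs_infty_ger.
apply: le_trans (expR_ge1Dx _); rewrite /freq -natr1; lra.
Unshelve. all: by end_near. Qed.

Definition initial_vec : c0 R := C0seq initial_vec_null.

Definition orbit_const : R := 1 + 2 * (2 * alpha) `^ (2 * alpha).

(** The two factors of exp(-L - t L^(-alpha)) are used separately: the damping
    yields t^2 L^(-2 alpha) <= 2 exp(t L^(-alpha)), and the loss L^(2 alpha) is
    absorbed by e^(-L). *)
Lemma rnorm_orbit_le t : 0 <= t ->
  rnorm (T t initial_vec) <= orbit_const / (1 + t ^+ 2).
Proof.
move=> t0; rewrite c0_rnormE; apply: c0norm_le => n.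
rewrite dsemigroupE// normcM normc_damped normc_real ?expR_ge0//.
have t1 : 0 < 1 + t ^+ 2 by rewrite ltr_pwDl// sqr_ge0.
rewrite ler_pdivlMr// mulrDr mulr1; apply: lerD.
  rewrite -expRD expR_le1; have := freq_gt0 n.
  by have := mulr_ge0 t0 (decay_ge0 n); lra.
have tE : t ^+ 2 = (t * decay n) ^+ 2 * freq n `^ (2 * alpha).
  rewrite exprMn -mulrA [2 * alpha]mulrC powRrM (powR_mulrn 2) ?powR_ge0//.
  by rewrite exprVn mulVf ?mulr1// expf_neq0// gt_eqF// powR_gt0 ?freq_gt0.
have H1 := sqr_le_expR (mulr_ge0 t0 (decay_ge0 n)).
have H2 : freq n `^ (2 * alpha) <= (2 * alpha) `^ (2 * alpha) * expR (freq n).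
  by apply: powR_le_expR; rewrite ?freq_gt0// mulr_gt0.
have := ler_pM (sqr_ge0 _) (powR_ge0 _ _) H1 H2; rewrite -tE => tle.
rewrite !expRN -invfM mulrC ler_pdivrMr ?mulr_gt0 ?expR_gt0//.
apply: (le_trans tle); rewrite le_eqVlt; apply/orP; left; apply/eqP; ring.
Qed.

Lemma integral_orbit_fin :
  (\int[lebesgue_measure]_(t in `[0%R, +oo[) (rnorm (T t initial_vec) `^ p)%:E < +oo)%E.
Proof.
have oneDsqr_gt0 (t : R) : 0 < oneDsqr t := lt_le_trans ltr01 (oneDsqr_ge1 t).
have C1 : 1 <= orbit_const by rewrite lerDl mulr_ge0// powR_ge0.
apply: (@le_lt_trans _ _
  (\int[lebesgue_measure]_(t in `[0%R, +oo[)
     ((orbit_const `^ p)%:E * (oneDsqr t)^-1%:E))%E).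
  apply: le_integral_nonneg => //.
  - by move=> t _; rewrite lee_fin powR_ge0.
  - move=> t _; rewrite -EFinM lee_fin mulr_ge0 ?powR_ge0//.
  - move=> t; rewrite /= in_itv/= andbT => t0; rewrite -EFinM lee_fin.
    apply: (@le_trans _ _ ((orbit_const / oneDsqr t) `^ p)).
      apply: le_powR2l; [exact: le_trans p_ge1| |exact: rnorm_orbit_le].
      by rewrite c0_rnormE c0norm_ge0.
    rewrite powRM ?invr_ge0 ?(ltW (oneDsqr_gt0 t)) ?(le_trans _ C1)//.
    rewrite ler_wpM2l ?powR_ge0// ge1r_powR// invr_gt0 oneDsqr_gt0/=.
    by rewrite invf_le1 ?oneDsqr_gt0// oneDsqr_ge1.
rewrite ge0_integralZl//.
- by rewrite integral0y_oneDsqr -EFinM ltry.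
- apply/measurable_EFinP; apply: measurable_funTS.
  exact: continuous_measurable_fun (@continuous_oneDsqrV R).
- by rewrite lee_fin powR_ge0.
Qed.

(** The norm is bounded below by the n-th coordinate.  Each of the damping,
    the division by the eigenvalue and the size of the initial vector
    contributes a factor of about exp(- freq n). *)
Lemma rnorm_orbit_inverse_ge t n : 0 <= t -> t <= freq n `^ (alpha + 1) + 1 ->
  expR (- (3 * freq n + 2)) <= rnorm (T t (generator_inv initial_vec)).
Proof.
move=> t0 tn; rewrite c0_rnormE.
apply: le_trans (normc_le_c0norm (T t (generator_inv initial_vec)) n).
rewrite dsemigroupE// diagE !normcM normc_damped normc_real ?expR_ge0// normcV.
have lam0 : 0 < normc (lam n).
  by apply: lt_le_trans (Im_le_normc (lam n)); rewrite /= normr_gt0 gt_eqF ?expR_gt0.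
have lam_le : normc (lam n) <= expR (freq n + 1).
  apply: (le_trans (normc_le_ReIm _)); rewrite /= normrN.
  rewrite !ger0_norm ?expR_ge0 ?decay_ge0//.
  rewrite expRD; have := decay_le1 n; have := @expR_ge1Dx R 1.
  have : 1 <= osc n by rewrite -expR0 ler_expR ltW ?freq_gt0.
  rewrite /osc; nra.
have ta : t * decay n <= freq n + 1.
  apply: (@le_trans _ _ ((freq n `^ (alpha + 1) + 1) * decay n)).
    by rewrite ler_wpM2r ?decay_ge0.
  rewrite mulrDl mul1r lerD ?decay_le1// powRD; last first.
    by rewrite (gt_eqF (freq_gt0 n)) implybT.
  rewrite powRr1 ?(ltW (freq_gt0 n))// mulrAC mulfV ?mul1r//.
  by rewrite gt_eqF// powR_gt0 ?freq_gt0.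
have -> : - (3 * freq n + 2) = - (freq n + 1) + (- (freq n + 1) + - freq n) by ring.
rewrite !expRD; apply: ler_pM; rewrite ?mulr_ge0 ?expR_ge0//.
  by rewrite ler_expR lerN2.
by rewrite ler_wpM2r ?expR_ge0// expRN lef_pV2 ?posrE ?expR_gt0.
Qed.

(** On [tau, tau + 1], where tau = L^(alpha+1), the integrand is at least
    exp(-(3L + 2)p + (3p + 1)L) = exp(L - 2p). *)
Lemma integral_orbit_inverse_infty :
  (\int[lebesgue_measure]_(t in `[0%R, +oo[)
     (rnorm (T t (generator_inv initial_vec)) `^ p
       * expR ((3 * p + 1) * t `^ ((alpha + 1)^-1)))%:E = +oo)%E.
Proof.
have p0 : 0 <= p by exact: le_trans p_ge1.
have a1 : 0 < alpha + 1 by rewrite addr_gt0.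
set I := (X in X = _).
have In n : ((expR (- (2 * p)) * freq n)%:E <= I)%E.
  set tau := freq n `^ (alpha + 1).
  have tau0 : 0 <= tau by exact: powR_ge0.
  have -> : (expR (- (2 * p)) * freq n)%:E =
      (\int[lebesgue_measure]_(t in `[tau, (tau + 1)%R])
        (expR (- (2 * p)) * freq n)%:E)%E.
    rewrite integral_cst//= lebesgue_measure_itv/= lte_fin ltrDl ltr01.
    by rewrite -EFinB addrAC subrr add0r mule1.
  apply: le_integral_nonneg.
  - move=> t; rewrite /= !in_itv/= andbT => /andP[+ _]; exact: le_trans.
  - by move=> t _; rewrite lee_fin mulr_ge0 ?expR_ge0// ltW ?freq_gt0.
  - by move=> t _; rewrite lee_fin mulr_ge0 ?expR_ge0 ?powR_ge0.
  - move=> t; rewrite /= in_itv/= => /andP[taut ttau]; rewrite lee_fin.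
    have t0 : 0 <= t by exact: le_trans taut.
    apply: (@le_trans _ _ (expR (- (3 * freq n + 2) * p) * expR ((3 * p + 1) * freq n))).
      rewrite -expRD (_ : _ + _ = - (2 * p) + freq n); last by ring.
      rewrite expRD ler_wpM2l ?expR_ge0//; apply: le_trans (expR_ge1Dx _); lra.
    apply: ler_pM; rewrite ?expR_ge0//.
      rewrite expRM; apply: le_powR2l => //.
      exact: rnorm_orbit_inverse_ge.
    rewrite ler_expR ler_wpM2l//; first by rewrite addr_ge0// mulr_ge0.
    have -> : freq n = tau `^ (alpha + 1)^-1.
      by rewrite -powRrM mulfV ?lt0r_neq0// powRr1// (ltW (freq_gt0 n)).
    by apply: le_powR2l; rewrite ?invr_ge0 ?(ltW a1).
apply/eqyP => r r0.
near \oo => n.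
apply: le_trans (In n); rewrite lee_fin.
rewrite mulrC -ler_pdivrMr ?expR_gt0// /freq.
apply: (@le_trans _ _ n%:R); last by rewrite ler_nat.
by near: n; exact: nbhs_infty_ger.
Unshelve. all: by end_near. Qed.

End Example.

Theorem theorem7p2 (R : realType) (alpha p : R) (alpha_gt0 : 0 < alpha)
    (p_ge1 : 1 <= p) :
  exists gamma : R, 0 < gamma /\
  exists (X : completeNormedModType R[i]) (T : R -> {linear X -> X})
         (A : operator X) (f : X),
    [/\ C0_semigroup T, bounded_semigroup T & A = generator T] /\
    [/\ (exists RA : R -> {linear X -> X},
          (forall s : R, is_resolvent (0 +i* s) A (RA s)) /\
          exists C s0 : R, forall s : R, s0 <= `|s| ->
            (opnorm (RA s) <= (C * ln `|s| `^ alpha)%:E)%E),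
        (\int[lebesgue_measure]_(t in `[0%R, +oo[)
            (rnorm (T t f) `^ p)%:E < +oo)%E &
        (exists Ainv : {linear X -> X},
          is_inverse A Ainv /\
          \int[lebesgue_measure]_(t in `[0%R, +oo[)
            (rnorm (T t (Ainv f)) `^ p
              * expR (gamma * t `^ ((alpha + 1)^-1)))%:E = +oo)%E].
Proof.
exists (3 * p + 1); split; first lra.
pose T := dsemigroup osc (decay_ge0 alpha).
exists (c0 R), T, (generator T), initial_vec; split.
  by split; [exact: dsemigroup_C0|exact: dsemigroup_bounded|].
split.
- exists (resolvent alpha_gt0); split; first exact: is_resolvent_dsemigroup.
  exists (2 `^ alpha), (expR 1); exact: opnorm_resolvent_le.
- exact: integral_orbit_fin.
- exists (generator_inv alpha); split; first exact: is_inverse_generator_inv.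
  exact: integral_orbit_inverse_infty.
Qed.
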